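(* Let $G$ be a mixed unit interval graph on $n$ vertices. Then $\mathrm{cwd}(G)\le 2\alpha(G)+3$, where $\alpha(G)$ is the maximum size of an independent set of $G$. Moreover, a $(2\alpha(G)+3)$-expression defining $G$ can be constructed in $O(n)$ time provided a $\mathcal{U}$-bubble model of $G$ is given.
   Context: Clique-width: $\mathrm{cwd}(G)$ is the smallest $k$ such that $G$ can be constructed using at most $k$ labels by the operations: creating a single vertex with label $i$; disjoint union $\oplus$; relabeling all labels $i$ to $j$; and, for $i\ne j$, adding all edges between vertices labelled $i$ and vertices labelled $j$. Such a term using at most $k$ labels is a $k$-expression. A mixed unit interval graph is an intersection graph of unit intervals, each closed, open or half-open. A 2-dimensional $\mathcal{U}$-bubble structure for a finite nonempty set $A$ is a family $\mathcal{B}=\langle B_{i,j}\rangle_{1\le j\le k,\,1\le i\le r_j}$ of pairwise disjoint (possibly empty) sets (''bubbles'') with union $A$, each partitioned into quadrants $B_{i,j}=B^{++}_{i,j}\cup B^{+-}_{i,j}\cup B^{-+}_{i,j}\cup B^{--}_{i,j}$; $B^{*+}_{i,j}=B^{++}_{i,j}\cup B^{-+}_{i,j}$, $B^{+*}_{i,j}=B^{++}_{i,j}\cup B^{+-}_{i,j}$. Column $j$ consists of the bubbles with second index $j$; row $i$ of those with first index $i$. The graph $G(\mathcal{B})$ has vertex set $A$, and distinct $u,v$ are adjacent iff, for some ordering, $u\in B_{i,j}$, $v\in B_{i',j'}$ and: (a) $j=j'$; or (b) $j=j'-1$ and $i>i'$; or (c) $j=j'-1$, $i=i'$, $u\in B^{*+}_{i,j}$,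 $v\in B^{+*}_{i',j'}$. A $\mathcal{U}$-bubble model of $G$ is such a structure for $V(G)$ with $G\cong G(\mathcal{B})$, every row and column containing a nonempty bubble, $B_{r_j,j}\ne\emptyset$ for all $j$, and with $\mathrm{top}(j)=\min\{i:B_{i,j}\ne\emptyset\}$, $\mathrm{top}(1)=1$, $\mathrm{top}(j)\le \mathrm{top}(j+1)$. *)

(* Defs.v *)
From HB Require Import structures.
From mathcomp Require Import all_boot all_order all_algebra.
From mathcomp Require Import boolp reals.

Set Implicit Arguments.
Unset Strict Implicit.
Unset Printing Implicit Defensive.

Import Order.TTheory GRing.Theory Num.Theory.

Record sgraph := SGraph {
  svertex :> finType;
  sedge : rel svertex;
  sedge_sym : symmetric sedge;
  sedge_irrefl : irreflexive sedge }.

Definition independent (G : sgraph) (S : {set G}) : bool :=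
  [forall x in S, forall y in S, ~~ sedge x y].

Definition alpha (G : sgraph) : nat :=
  \max_(S : {set G} | independent S) #|S|.

(* All four combinations of the booleans [bl], [br] are allowed: [BSide true]
   is a closed left end and an open right end, [BSide false] the converse. *)
Definition unit_interval (R : realType) (I : interval R) : Prop :=
  exists (a : R) (bl br : bool),
    I = Interval (BSide bl a) (BSide br (a + 1)%R).

Definition mixed_unit_interval_graph (R : realType) (G : sgraph) : Prop :=
  exists I : G -> interval R,
    (forall x, unit_interval (I x)) /\
    (forall x y, sedge x y <->
       x <> y /\ exists z : R, (z \in I x) && (z \in I y)).

Inductive cwterm :=
  | Vertex of nat
  | Union of cwterm & cwterm
  | Relabel of nat & nat & cwterm
  | Join of nat & nat & cwterm.

Record lgraph := LGraph {
  lvertex : finType;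
  ledge : rel lvertex;
  llabel : lvertex -> nat }.

Definition union_edge (A B : Type) (eA : rel A) (eB : rel B) : rel (A + B) :=
  fun u v => match u, v with
             | inl x, inl y => eA x y
             | inr x, inr y => eB x y
             | _, _ => false
             end.

Definition union_label (A B : Type) (lA : A -> nat) (lB : B -> nat)
    (u : A + B) : nat :=
  match u with inl x => lA x | inr y => lB y end.

Fixpoint value (t : cwterm) : lgraph :=
  match t with
  | Vertex i => @LGraph unit (fun _ _ => false) (fun _ => i)
  | Union t1 t2 =>
      @LGraph (lvertex (value t1) + lvertex (value t2))%type
        (union_edge (@ledge (value t1)) (@ledge (value t2)))
        (union_label (@llabel (value t1)) (@llabel (value t2)))
  | Relabel i j t1 =>
      @LGraph (lvertex (value t1)) (@ledge (value t1))
        (fun x => if llabel x == i then j else llabel x)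
  | Join i j t1 =>
      @LGraph (lvertex (value t1))
        (fun x y => [|| ledge x y,
                        (llabel x == i) && (llabel y == j) |
                        (llabel x == j) && (llabel y == i)])
        (@llabel (value t1))
  end.

Fixpoint labels (t : cwterm) : seq nat :=
  match t with
  | Vertex i => [:: i]
  | Union t1 t2 => labels t1 ++ labels t2
  | Relabel i j t1 => [:: i, j & labels t1]
  | Join i j t1 => [:: i, j & labels t1]
  end.

Fixpoint cwterm_wf (t : cwterm) : bool :=
  match t with
  | Vertex _ => true
  | Union t1 t2 => cwterm_wf t1 && cwterm_wf t2
  | Relabel _ _ t1 => cwterm_wf t1
  | Join i j t1 => (i != j) && cwterm_wf t1
  end.

Definition k_expression (k : nat) (t : cwterm) : bool :=
  cwterm_wf t && (size (undup (labels t)) <= k).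

Definition defines (t : cwterm) (G : sgraph) : Prop :=
  exists f : G -> lvertex (value t),
    bijective f /\ forall x y, sedge x y = ledge (f x) (f y).

(* No term builds the graph without vertices; its clique-width is 0. *)
Definition cwd_le (G : sgraph) (k : nat) : bool :=
  `[< #|G| = 0 \/ exists t, k_expression k t /\ defines t G >].

Section CwdExists.
Variable G : sgraph.

Let rk (x : G) : nat := enum_rank x.

Let rk_inj : injective rk.
Proof. by move=> x y /val_inj /enum_rank_inj. Qed.

Definition reps (t : cwterm) (s : seq G) (E : rel G) : Prop :=
  cwterm_wf t /\
  exists f : lvertex (value t) -> G,
    [/\ injective f, forall x, x \in s <-> exists a, f a = x,
        forall a b, ledge a b = E (f a) (f b)
      & forall a, llabel a = rk (f a)].

Let eq_reps t s E E' : {in s &, E =2 E'} -> reps t s E -> reps t s E'.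
Proof.
move=> eE [wt [f [fi fs fe fl]]]; split=> //; exists f; split=> // a b.
by rewrite fe eE //; apply/fs; [exists a | exists b].
Qed.

Let reps_joins y (l : seq G) t s E : y \notin l -> reps t s E ->
  exists t', reps t' s (fun u v => [|| E u v, (u == y) && (v \in l)
                                            | (v == y) && (u \in l)]).
Proof.
move=> yl rt; elim: l yl => [|z l IH] => [_|].
  by exists t; apply: eq_reps rt => u v _ _; rewrite !in_nil !andbF !orbF.
rewrite inE negb_or => /andP[yz /IH [t' [wt [f [fi fs fe fl]]]]].
exists (Join (rk y) (rk z) t'); split=> /=.
  by rewrite wt andbT; apply: contra yz => /eqP/rk_inj ->.
exists f; split=> // a b /=; rewrite fe !fl !(inj_eq rk_inj) !inE.
case: (E _ _) => //=; case: (f a == y); case: (f b == y);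
  case: (f a == z); case: (f b == z); rewrite ?orbT ?orbF //=;
  by case: (f a \in l); case: (f b \in l).
Qed.

Let reps_cons y t s E : y \notin s -> reps t s E ->
  reps (Union t (Vertex (rk y))) (y :: s)
    (fun u v => [&& E u v, u \in s & v \in s]).
Proof.
move=> ys [wt [f [fi fs fe fl]]]; split=> /=; first by rewrite wt.
have fin a : f a \in s by apply/fs; exists a.
pose g (u : lvertex (value t) + unit) := if u is inl a then f a else y.
exists g; split.
- move=> [a|[]] [b|[]] //= => [/fi -> // | ab | ab].
    by rewrite -ab fin in ys.
  by rewrite ab fin in ys.
- move=> x; rewrite inE; split.
    by case/orP=> [/eqP->|/fs [a <-]]; [exists (inr tt) | exists (inl a)].
  by move=> [[a|[]] <-] /=; rewrite ?eqxx // fin orbT.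
- by move=> [a|[]] [b|[]] //=; rewrite ?(negPf ys) ?andbF // fe !fin !andbT.
- by move=> [a|[]] //=; rewrite fl.
Qed.

Let reps_exists (s : seq G) : uniq s -> s != [::] ->
  exists t, reps t s (@sedge G).
Proof.
elim: s => // y s IH /= /andP[ys us] _.
case: (eqVneq s [::]) => [->|/(IH us) [t rt]].
  exists (Vertex (rk y)); split=> //; exists (fun=> y); split=> //.
  - by move=> [] [].
  - by move=> x; rewrite inE; split=> [/eqP->|[_ ->]]; [exists tt|].
  - by move=> a b /=; rewrite sedge_irrefl.
have /(_ y [seq z <- s | sedge y z]) := reps_joins _ (reps_cons ys rt).
rewrite mem_filter (negPf ys) andbF => /(_ isT) [t' rt']; exists t'.
apply: eq_reps rt' => u v; rewrite !mem_filter !inE.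
case: (eqVneq u y) => [->|uy]; case: (eqVneq v y) => [->|vy] //=.
- by rewrite (negPf ys) sedge_irrefl !andbF.
- by move=> _ ->; rewrite (negPf ys) andbF orbF andbT.
- by move=> -> _; rewrite (negPf ys) !andbF andbT sedge_sym.
- by move=> -> ->; rewrite !andbT orbF.
Qed.

Lemma cwd_exists : exists k, cwd_le G k.
Proof.
case: (posnP #|G|) => [G0|G0]; first by exists 0; apply/asboolP; left.
have [|t [wt [f [fi fs fe _]]]] := @reps_exists (enum G) (enum_uniq G).
  by rewrite -size_eq0 -cardE -lt0n.
exists (size (undup (labels t))); apply/asboolP; right; exists t.
split; first by rewrite /k_expression wt leqnn.
have fsurj x : {a | f a == x}.
  by apply: sigW; have /fs [a <-] := mem_enum G x; exists a.
pose g x := sval (fsurj x).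
have gK : cancel g f by move=> x; apply/eqP; exact: (svalP (fsurj x)).
exists g; split; last by move=> x y; rewrite fe !gK.
by exists f => // a; apply: fi; rewrite gK.
Qed.

End CwdExists.

Definition cwd (G : sgraph) : nat := ex_minn (cwd_exists G).

(* Indices are 1-based; [quadrant i j s t] is the quadrant of row i, column j
   with signs s t, [true] standing for +, and is empty when (i, j) is outside
   the index set. *)
Record bubble_structure (A : finType) := BubbleStructure {
  ncols : nat;
  nrows : nat -> nat;
  quadrant : nat -> nat -> bool -> bool -> {set A};
  bubble_carrier : 0 < #|A|;
  quadrant_index : forall x i j s t, x \in quadrant i j s t ->
    (1 <= j <= ncols) && (1 <= i <= nrows j);
  quadrant_cover : forall x, exists i j s t, x \in quadrant i j s t;
  quadrant_disjoint : forall x i j s t i' j' s' t',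
    x \in quadrant i j s t -> x \in quadrant i' j' s' t' ->
    [/\ i = i', j = j', s = s' & t = t'] }.

Section Bubble.
Variables (A : finType) (B : bubble_structure A).

Definition bubble (i j : nat) : {set A} :=
  quadrant B i j true true :|: quadrant B i j true false :|:
  quadrant B i j false true :|: quadrant B i j false false.

Definition bubble_xp (i j : nat) : {set A} :=
  quadrant B i j true true :|: quadrant B i j false true.

Definition bubble_px (i j : nat) : {set A} :=
  quadrant B i j true true :|: quadrant B i j true false.

Definition bubble_adj_ordered (u v : A) : Prop :=
  exists i j i' j', [/\ u \in bubble i j, v \in bubble i' j' &
    [\/ j = j',
        j.+1 = j' /\ i > i'
      | [/\ j.+1 = j', i = i', u \in bubble_xp i j & v \in bubble_px i' j']]].

Definition bubble_adj (u v : A) : Prop :=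
  u <> v /\ (bubble_adj_ordered u v \/ bubble_adj_ordered v u).

(* [find] returns the position in [iota 0 _], i.e., the row index itself;
   row 0 is always empty. *)
Definition top (j : nat) : nat :=
  find (fun i => bubble i j != set0) (iota 0 (nrows B j).+1).

End Bubble.

Definition bubble_model (G : sgraph) (B : bubble_structure G) : Prop :=
  (exists f : G -> G,
     bijective f /\ forall x y, sedge x y <-> bubble_adj B (f x) (f y)) /\
  [/\ forall j, 1 <= j <= ncols B ->
        exists i, bubble B i j != set0,
      forall i j, 1 <= j <= ncols B -> 1 <= i <= nrows B j ->
        exists j', bubble B i j' != set0,
      forall j, 1 <= j <= ncols B -> bubble B (nrows B j) j != set0,
      top B 1 = 1
    & forall j, 1 <= j < ncols B -> top B j <= top B j.+1].

(* Word RAM with finitely many registers and arrays in each program, +, -,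
   comparisons and indirect access, at unit cost.  Words range over 0..W; an
   instruction whose result exceeds W has no successor state.  Since Const and
   Add are the only instructions creating new values, all words of a run stay
   in 0..W as soon as the input does. *)
Inductive instr :=
  | Const of nat & nat           (* x := c *)
  | Add of nat & nat & nat       (* x := y + z *)
  | Sub of nat & nat & nat       (* x := y - z, truncated at 0 *)
  | Get of nat & nat & nat       (* x := a[y] *)
  | Put of nat & nat & nat       (* a[y] := x, arguments in the order a y x *)
  | Write of nat.                (* append x to the output *)

Inductive test := Lt of nat & nat | Eq of nat & nat.

Inductive prog :=
  | Skip
  | Do of instr
  | Seq of prog & prog
  | If of test & prog & prog
  | While of test & prog.

Record state := State {
  reg : nat -> nat;
  arr : nat -> nat -> nat;
  out : seq nat }.

Definition upd (T : Type) (f : nat -> T) (x : nat) (v : T) : nat -> T :=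
  fun y => if y == x then v else f y.

Definition set_reg (s : state) (x v : nat) : state :=
  State (upd (reg s) x v) (arr s) (out s).

Definition step (W : nat) (i : instr) (s : state) : option state :=
  match i with
  | Const x c => if c <= W then Some (set_reg s x c) else None
  | Add x y z =>
      if reg s y + reg s z <= W then Some (set_reg s x (reg s y + reg s z))
      else None
  | Sub x y z => Some (set_reg s x (reg s y - reg s z))
  | Get x a y => Some (set_reg s x (arr s a (reg s y)))
  | Put a y x =>
      Some (State (reg s)
                  (upd (arr s) a (upd (arr s a) (reg s y) (reg s x)))
                  (out s))
  | Write x => Some (State (reg s) (arr s) (rcons (out s) (reg s x)))
  end.

Definition holds (b : test) (s : state) : bool :=
  match b with
  | Lt x y => reg s x < reg s y
  | Eq x y => reg s x == reg s y
  end.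

(* [run W p s T s']: p started in s halts in s' after T steps. *)
Inductive run (W : nat) : prog -> state -> nat -> state -> Prop :=
  | RunSkip s : run W Skip s 0 s
  | RunDo i s s' : step W i s = Some s' -> run W (Do i) s 1 s'
  | RunSeq p q s T s1 T' s2 : run W p s T s1 -> run W q s1 T' s2 ->
      run W (Seq p q) s (T + T') s2
  | RunIfTrue b p q s T s' : holds b s -> run W p s T s' ->
      run W (If b p q) s T.+1 s'
  | RunIfFalse b p q s T s' : ~~ holds b s -> run W q s T s' ->
      run W (If b p q) s T.+1 s'
  | RunWhileTrue b p s T s1 T' s2 : holds b s -> run W p s T s1 ->
      run W (While b p) s1 T' s2 -> run W (While b p) s (T + T').+1 s2
  | RunWhileFalse b p s : ~~ holds b s -> run W (While b p) s 1 s.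

Record place := Place {
  prow : nat; pcol : nat; psign1 : bool; psign2 : bool }.

(* l gives, for the vertices of A numbered 0..#|A|-1 in some arbitrary order,
   the quadrant containing each of them. *)
Definition listing (A : finType) (B : bubble_structure A) (l : seq place) :
    Prop :=
  exists (e : seq A) (w : A -> place),
    [/\ perm_eq e (enum A),
        forall x, x \in quadrant B (prow (w x)) (pcol (w x))
                                   (psign1 (w x)) (psign2 (w x))
      & l = map w e].

(* Registers 0, 1: number of vertices, number of columns.  Arrays 0 to 3,
   indexed by vertices: row, column, first sign, second sign (+ is 1, - is 0).
   Array 4, indexed by columns j: r_j.  Everything else is 0.
   Storing the empty bubbles as well could take quadratic space. *)
Definition init (A : finType) (B : bubble_structure A) (l : seq place) :
    state :=
  State (nth 0 [:: size l; ncols B])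
        (nth (fun=> 0)
           [:: nth 0 (map prow l); nth 0 (map pcol l);
               nth 0 (map (fun p => psign1 p : nat) l);
               nth 0 (map (fun p => psign2 p : nat) l);
               fun j => if 1 <= j <= ncols B then nrows B j else 0])
        [::].

(* Reverse Polish notation: an opcode followed by its labels. *)
Fixpoint code (t : cwterm) : seq nat :=
  match t with
  | Vertex i => [:: 0; i]
  | Union t1 t2 => code t1 ++ code t2 ++ [:: 1]
  | Relabel i j t1 => code t1 ++ [:: 2; i; j]
  | Join i j t1 => code t1 ++ [:: 3; i; j]
  end.

(* Main.v *)
Require Import Defs.
From mathcomp Require Import all_boot all_order all_algebra.
From mathcomp Require Import boolp reals.
From mathcomp Require Import zify lra.

Set Implicit Arguments.
Unset Strict Implicit.
Unset Printing Implicit Defensive.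

(**
The vertices are inserted row by row, and from left to right inside a row.  A
vertex of column j is then adjacent to all vertices already present in columns
j and j + 1, to some of those of its own row in column j - 1, and to nothing
else; so one label per column suffices, plus three: one for the new vertex and
two for the vertices with second sign + of the last two bubbles.  Columns of
equal parity have no edges between them, hence there are at most 2 alpha
nonempty columns.

For unit intervals with left end points a, the column is the integral part of
a and the row is the rank of its fractional part.  For the time bound, two
bucket sorts put the vertices in the required order; this is linear because
in a bubble model all rows and columns are nonempty, hence at most n.
*)

(** * Building the term *)

(** Cases (b) and (c) of the adjacency in a bubble structure, with [p] in the left column. *)
Definition place_next (p q : place) : bool :=
  ((pcol p).+1 == pcol q) &&
  ((prow q < prow p) || [&& prow p == prow q, psign2 p & psign1 q]).

Definition place_adj (p q : place) : bool :=
  [|| pcol p == pcol q, place_next p q | place_next q p].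

(** The map goes from the term into [V], so a partly built graph needs no subtype of [V]; [E] and
    [lab] matter only on [s]. *)
Definition represents (V : finType) (t : cwterm) (s : seq V) (E : rel V)
    (lab : V -> nat) : Prop :=
  exists f : lvertex (value t) -> V,
    [/\ injective f, forall x, x \in s <-> exists a, f a = x,
        forall a b, ledge a b = E (f a) (f b)
      & forall a, llabel a = lab (f a)].

Definition join_if (b : bool) (i j : nat) (t : cwterm) : cwterm :=
  if b then Join i j t else t.

Section Represents.
Variable V : finType.
Implicit Types (s : seq V) (E : rel V) (lab : V -> nat).

Lemma eq_represents t s E E' lab lab' :
  {in s &, E =2 E'} -> {in s, lab =1 lab'} ->
  represents t s E lab -> represents t s E' lab'.
Proof.
move=> eE el [f [fi fs fe fl]]; exists f; split=> // [a b|a].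
  by rewrite fe eE //; apply/fs; [exists a | exists b].
by rewrite fl el //; apply/fs; exists a.
Qed.

Lemma represents_vertex i (x : V) :
  represents (Vertex i) [:: x] (fun _ _ => false) (fun=> i).
Proof.
exists (fun=> x); split=> //; first by move=> [] [].
by move=> y; rewrite inE; split=> [/eqP->|[_ ->]]; [exists tt|].
Qed.

Lemma represents_add t s E lab i x : x \notin s -> represents t s E lab ->
  represents (Union t (Vertex i)) (x :: s)
    (fun u v => [&& u \in s, v \in s & E u v])
    (fun u => if u == x then i else lab u).
Proof.
move=> xs [f [fi fs fe fl]].
have fin a : f a \in s by apply/fs; exists a.
have fx a : (f a == x) = false by apply: contraNF xs => /eqP <-; exact: fin.
pose g (u : lvertex (value t) + unit) := if u is inl a then f a else x.
exists g; split.
- move=> [a|[]] [b|[]] //= => [/fi -> // | /eqP | /esym/eqP]; by rewrite fx.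
- move=> y; rewrite inE; split.
    by case/orP=> [/eqP->|/fs [a <-]]; [exists (inr tt) | exists (inl a)].
  by move=> [[a|[]] <-] /=; rewrite ?eqxx // fin orbT.
- by move=> [a|[]] [b|[]] //=; rewrite ?(negPf xs) ?andbF // fe !fin.
- by move=> [a|[]] /=; rewrite ?fx ?eqxx ?fl.
Qed.

Lemma represents_join t s E lab i j : represents t s E lab ->
  represents (Join i j t) s
    (fun u v => [|| E u v, (lab u == i) && (lab v == j)
                         | (lab u == j) && (lab v == i)]) lab.
Proof.
by move=> [f [fi fs fe fl]]; exists f; split=> //= a b; rewrite fe !fl.
Qed.

Lemma represents_relabel t s E lab i j : represents t s E lab ->
  represents (Relabel i j t) s E (fun u => if lab u == i then j else lab u).
Proof. by move=> [f [fi fs fe fl]]; exists f; split=> //= a; rewrite fl. Qed.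

Lemma represents_join_if t s E lab b i j :
  represents t s E lab ->
  represents (join_if b i j t) s
    (fun u v => E u v || b && ((lab u == i) && (lab v == j)
                            || (lab u == j) && (lab v == i))) lab.
Proof.
case: b => rep; first exact: represents_join.
by apply: eq_represents rep => // u v _ _; rewrite orbF.
Qed.

End Represents.

Lemma represents_defines (G : sgraph) t s (lab : G -> nat) :
  (forall x, x \in s) -> represents t s (@sedge G) lab -> defines t G.
Proof.
move=> alls [f [fi fs fe _]].
have fsurj x : {a | f a == x}.
  by apply: sigW; have /fs [a <-] := alls x; exists a.
pose g x := sval (fsurj x).
have gK : cancel g f by move=> x; apply/eqP; exact: (svalP (fsurj x)).
exists g; split; last by move=> x y; rewrite fe !gK.
by exists f => // a; apply: fi; rewrite gK.
Qed.

(* [prev_bubble] and [cur_bubble] are the last two nonempty bubbles met, as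
   (row, column); both are the first bubble as long as only one was met. *)
Record builder := Builder {
  term : option cwterm;
  prev_bubble : nat * nat;
  cur_bubble : nat * nat }.

Definition key (p : place) : nat * nat := (prow p, pcol p).

(* Label [0] is for the vertex being added, [k.+1] and [k.+2] for the vertices
   with second sign + of [prev_bubble] and [cur_bubble], and the column of a
   vertex for all the others. *)
Section Build.
Variables (k : nat) (hascol : pred nat).

(** At a new bubble the label [k.+1] is first emptied into its column, and only then takes over the
    vertices labelled [k.+2]. *)
Definition enter (st : builder) (p : place) : builder :=
  if term st is Some t then
    if key p == cur_bubble st then st
    else Builder (Some (Relabel k.+2 k.+1 (Relabel k.+1 (prev_bubble st).2 t)))
                 (cur_bubble st) (key p)
  else Builder None (key p) (key p).

Definition add_vertex (o : option cwterm) : cwterm :=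
  if o is Some t then Union t (Vertex 0) else Vertex 0.

(** Whether [p] sees the vertices labelled [k.+1]. They have second sign +, so in the preceding
    column only the row and [psign1 p] remain to be tested; those in the next column were inserted
    earlier, hence lie in a smaller row. *)
Definition joins_prev (pk : nat * nat) (p : place) : bool :=
  [|| pk.2 == pcol p, pk.2 == (pcol p).+1
    | [&& pk.2.+1 == pcol p, pk.1 == prow p & psign1 p]].

(** Vertices labelled [k.+2] share the bubble of [p], so that join is unconditional. The guard
    [hascol] avoids labels of empty columns, and also the label [k.+1] when [p] is in column [k]. *)
Definition add_place (st : builder) (p : place) : builder :=
  let st1 := enter st p in
  let t := join_if (joins_prev (prev_bubble st1) p) 0 k.+1
            (Join 0 k.+2
              (join_if (hascol (pcol p).+1) 0 (pcol p).+1
                (Join 0 (pcol p) (add_vertex (term st1))))) in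
  Builder (Some (Relabel 0 (if psign2 p then k.+2 else pcol p) t))
          (prev_bubble st1) (cur_bubble st1).

Definition build (l : seq place) : builder :=
  foldl add_place (Builder None (0, 0) (0, 0)) l.

Definition place_label (st : builder) (p : place) : nat :=
  if psign2 p && (key p == cur_bubble st) then k.+2
  else if psign2 p && (key p == prev_bubble st) then k.+1 else pcol p.

(** * Invariant of the insertion process *)

Section Correct.
Variables (G : sgraph) (pl : G -> place).
Hypothesis edgeE : forall x y, sedge x y = (x != y) && place_adj (pl x) (pl y).
Hypothesis col_bound : forall x, 0 < pcol (pl x) <= k.
Hypothesis hascolE : forall x, hascol (pcol (pl x)).
Hypothesis hascolP : forall j, hascol j -> exists x, pcol (pl x) = j.

Definition key_lt (a b : nat * nat) : bool :=
  (a.1 < b.1) || (a.1 == b.1) && (a.2 < b.2).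

Definition usable (i : nat) : Prop :=
  i \in [:: 0; k.+1; k.+2] \/ exists x, pcol (pl x) = i.

(* The clause on [key_lt] says that no nonempty bubble lies strictly between
   [prev_bubble] and [cur_bubble], so the only vertices that a new vertex of
   [cur_bubble] may have to distinguish inside their column are labelled
   [k.+1]. *)
Definition build_inv (s : seq G) (st : builder) : Prop :=
  [/\ exists t, [/\ term st = Some t, cwterm_wf t,
        represents t s (@sedge G) (fun x => place_label st (pl x)) &
        forall i, i \in labels t -> usable i],
      forall x, x \in s -> (key (pl x) == cur_bubble st) ||
        key_lt (prev_bubble st) (cur_bubble st) && ~~ key_lt (prev_bubble st) (key (pl x)) &
      exists x, pcol (pl x) = (cur_bubble st).2] /\
  exists x, pcol (pl x) = (prev_bubble st).2.

Lemma enter_inv s st x : build_inv s st -> ~~ key_lt (key (pl x)) (cur_bubble st) ->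
  build_inv s (enter st (pl x)) /\ cur_bubble (enter st (pl x)) = key (pl x).
Proof.
case: st => o [pr pc] [qr qc] [[[t [/= -> wf rep lb]] ord qcE] pcE] lex.
rewrite /enter /=; case: eqP => [->|/eqP].
  by split=> //; split=> //; split=> //; exists t.
rewrite xpair_eqE => ne; split=> //.
have [[y yE] [z zE]] := (qcE, pcE).
do 2![split=> //=]; last by exists x.
- exists (Relabel k.+2 k.+1 (Relabel k.+1 pc t)); split=> //; last first.
    move=> i /=; rewrite !inE => /or4P[/eqP->|/eqP->|/eqP->|/orP[/eqP->|/lb//]].
    + by left; rewrite !inE eqxx !orbT.
    + by left; rewrite !inE eqxx !orbT.
    + by left; rewrite !inE eqxx !orbT.
    + by right.
  have := represents_relabel k.+2 k.+1 (represents_relabel k.+1 pc rep).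
  (* By [ord] no old vertex lies beyond the former current bubble, so none is in the new one;
     [col_bound] keeps column labels apart from [k.+1] and [k.+2]. *)
  apply: eq_represents => // u /ord /=; rewrite /place_label /=.
  rewrite /key_lt /= !xpair_eqE /=; move: lex; rewrite /key_lt /=.
  have := col_bound u; have := col_bound z; rewrite zE.
  by move: ne; case: (psign2 (pl u)) => /=; repeat case: ifP => /=; lia.
- move=> u /ord; move: lex; rewrite /key_lt /= !xpair_eqE; lia.
Qed.

(** The intermediate state in which [x] is present with label [0] and still isolated; it is common
    to the first and to the later insertions. *)
Definition entered (s : seq G) (st : builder) (x : G) : Prop :=
  [/\ [/\ cwterm_wf (add_vertex (term st)),
          represents (add_vertex (term st)) (x :: s)
            (fun u v => [&& u \in s, v \in s & sedge u v])
            (fun u => if u == x then 0 else place_label st (pl u)) &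
          forall i, i \in labels (add_vertex (term st)) -> usable i],
      forall y, y \in s -> (key (pl y) == cur_bubble st) ||
        key_lt (prev_bubble st) (cur_bubble st) && ~~ key_lt (prev_bubble st) (key (pl y)),
      cur_bubble st = key (pl x) & exists y, pcol (pl y) = (prev_bubble st).2].

Lemma enter_first x : entered [::] (enter (Builder None (0, 0) (0, 0)) (pl x)) x.
Proof.
split=> //; last by exists x.
split=> //=; last by move=> i; rewrite inE => /eqP->; left.
by apply: eq_represents (represents_vertex 0 x) => // u; rewrite inE => ->.
Qed.

Lemma enter_next s st x : x \notin s -> build_inv s st ->
  ~~ key_lt (key (pl x)) (cur_bubble st) -> entered s (enter st (pl x)) x.
Proof.
move=> xs inv lex; have [[[[t [tE wf rep lb]] ord _] pE] curE] := enter_inv inv lex.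
split=> //; rewrite tE; split=> /=; first by rewrite wf.
  exact: represents_add.
by move=> i; rewrite mem_cat inE => /orP[/lb//|/eqP->]; left.
Qed.

Lemma add_place_inv s st x : x \notin s -> entered s (enter st (pl x)) x ->
  build_inv (x :: s) (add_place st (pl x)).
Proof.
move=> xs; rewrite /add_place.
case: (enter st (pl x)) => o [pr pc] [qr qc] [] /= [wf rep lb] ord [qrE qcE] [z zE].
subst qr qc.
have colx := col_bound x.
split; last by exists z.
split; last by exists x.
- rewrite /=; eexists; split; first by [].
  + rewrite /join_if; move: (add_vertex o) (wf) => t wt.
    by case: (joins_prev _ _); case: (hascol _) => /=; rewrite wt ?andbT; lia.
  + have := represents_relabel 0 (if psign2 (pl x) then k.+2 else pcol (pl x))
      (represents_join_if (joins_prev (pr, pc) (pl x)) 0 k.+1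
      (represents_join 0 k.+2
      (represents_join_if (hascol (pcol (pl x)).+1) 0 (pcol (pl x)).+1
      (represents_join 0 (pcol (pl x)) rep)))).
    (* Columns start at [1], so label [0] belongs to the new vertex alone and the joins create no
       edge between old vertices. *)
    have labN u : place_label (Builder o (pr, pc) (key (pl x))) (pl u) != 0.
      by rewrite /place_label; have := col_bound u; do 2![case: ifP => // _]; lia.
    (* The joined labels are exactly those of the neighbours of [x]. The delicate case is a
       neighbour in the column before: it lies in the row of [x] and has second sign +. No nonempty
       bubble is strictly between [prev_bubble] and [cur_bubble], so its bubble is [prev_bubble] and
       its label [k.+1]. *)
    have labx v : v \in s ->
      let l := place_label (Builder o (pr, pc) (key (pl x))) (pl v) in
      [|| l == pcol (pl x),
          hascol (pcol (pl x)).+1 && (l == (pcol (pl x)).+1), l == k.+2 |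
          joins_prev (pr, pc) (pl x) && (l == k.+1)] =
      place_adj (pl x) (pl v).
      move=> vs; have := ord v vs; rewrite /place_label /key_lt /= !xpair_eqE.
      rewrite /place_adj /place_next /joins_prev /=.
      have := col_bound v; have := hascolE v.
      have [e|] := pcol (pl v) =P (pcol (pl x)).+1.
        rewrite e => ->; by case: (psign2 (pl v)) => /=; case: (psign1 (pl x)) => /=;
          repeat case: ifP => /=; lia.
      (* A guarded label is a genuine column, hence at most [k] and different from [k.+1]. *)
      have hx : hascol (pcol (pl x)).+1 -> pcol (pl x) < k.
        by move=> /hascolP[y <-]; have /andP[] := col_bound y.
      by move: hx; case: (hascol (pcol (pl x)).+1) => /=; case: (psign2 (pl v)) => /=;
        case: (psign1 (pl x)) => /=; repeat case: ifP => /=; lia.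
    apply: eq_represents => [u v|u]; last first.
      rewrite inE /place_label /=; case: eqVneq => [->|ux] /=.
        by rewrite eqxx !andbT; case: (psign2 _).
      by move=> us; have /negPf := labN u; rewrite /place_label => ->.
    rewrite !inE edgeE.
    have [->|ux] := eqVneq u x; have [->|vx] := eqVneq v x => /= us vs.
    * by rewrite (negPf xs) /=; case: (hascol _); case: (joins_prev _ _); lia.
    * rewrite (negPf xs) /= -(labx v vs) /=; have := labN v.
      move: (place_label _ _) => L.
      by case: (hascol _); case: (joins_prev _ _) => /=; lia.
    * have -> : place_adj (pl u) (pl x) = place_adj (pl x) (pl u).
        by rewrite /place_adj eq_sym; congr (_ || _); rewrite orbC.
      rewrite (negPf xs) andbF /= -(labx u us) /=; have := labN u.
      move: (place_label _ _) => L.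
      by case: (hascol _); case: (joins_prev _ _) => /=; lia.
    * rewrite us vs /=; have := labN u; have := labN v.
      move: (place_label _ (pl u)) (place_label _ (pl v)) => L M.
      by case: (_ && place_adj _ _) => //=; case: (hascol _); case: (joins_prev _ _) => /=; lia.
  + have ux : usable (pcol (pl x)) by right; exists x.
    have u0 : usable 0 by left.
    have uP : usable k.+1 by left; rewrite !inE eqxx orbT.
    have uQ : usable k.+2 by left; rewrite !inE eqxx !orbT.
    have labJ (b : bool) i j t : usable i -> (b -> usable j) ->
      {in labels t, forall m, usable m} ->
      {in labels (join_if b i j t), forall m, usable m}.
      move=> ui uj ut m; case: b uj => /= uj; last exact: ut.
      by rewrite !inE => /or3P[/eqP->//|/eqP->|/ut//]; exact: uj.
    move=> i /=; rewrite !inE => /or3P[/eqP->//|/eqP->|].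
      by case: ifP.
    apply: (labJ) => // {}i; apply: (labJ true) => // {}i; apply: (labJ) => //.
      by move=> /hascolP; right.
    exact: (labJ true).
- move=> y; rewrite inE => /orP[/eqP->|/ord//]; by rewrite eqxx.
Qed.

Lemma foldl_add_place_inv l s st : uniq l -> {in l, forall x, x \notin s} ->
  build_inv s st -> pairwise (fun x y => ~~ key_lt (key (pl y)) (key (pl x))) l ->
  {in l, forall x, ~~ key_lt (key (pl x)) (cur_bubble st)} ->
  build_inv (rev l ++ s) (foldl add_place st (map pl l)).
Proof.
elim: l s st => [|x l IH] //= s st /andP[xl ul] ls inv /andP[/allP lx pw] lcur.
have xs : x \notin s by apply: ls; rewrite mem_head.
have ent := enter_next xs inv (lcur x (mem_head _ _)).
rewrite rev_cons cat_rcons; apply: IH => //.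
- move=> y yl; rewrite inE negb_or ls ?inE ?yl ?orbT // andbT.
  by apply: contraNneq xl => <-.
- exact: add_place_inv.
- move=> y yl; have [_ _ /= -> _] := ent; exact: lx.
Qed.

Lemma build_correct l : 0 < size l -> perm_eq l (enum G) ->
  pairwise (fun x y => ~~ key_lt (key (pl y)) (key (pl x))) l ->
  exists t, [/\ term (build (map pl l)) = Some t, cwterm_wf t, defines t G &
    forall i, i \in labels t -> usable i].
Proof.
case: l => // x l _ lG /= /andP[/allP lx pw].
have /= /andP[xl ul] : uniq (x :: l) by rewrite (perm_uniq lG) enum_uniq.
have ent := enter_first x.
have inv := add_place_inv (isT : x \notin [::]) ent.
have [||[[t [tE wf rep lb]] _ _] _] := foldl_add_place_inv ul _ inv pw.
- by move=> y yl; rewrite inE; apply: contraNneq xl => <-.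
- by move=> y yl; exact: lx.
exists t; split=> //; apply: represents_defines rep => y.
by rewrite mem_cat mem_rev !inE orbC -in_cons (perm_mem lG) mem_enum.
Qed.

End Correct.
End Build.

(** * Counting columns by the independence number *)

Section Alpha.
Variables (G : sgraph) (col : G -> nat).
Hypothesis edge_col : forall x y, sedge x y ->
  (col x <= (col y).+1) && (col y <= (col x).+1).

(** Distinct columns of equal parity differ by at least two and have no edges between them, so one
    vertex picked from each such column yields an independent set. *)
Lemma alpha_parity b (s : seq nat) : uniq s ->
  (forall i, i \in s -> odd i = b /\ exists x, col x = i) -> size s <= alpha G.
Proof.
move=> us sP.
pose S := [set x | (odd (col x) == b) && ([pick y | col y == col x] == Some x)].
have indS : independent S.
  apply/forall_inP => x; rewrite inE => /andP[/eqP ox /eqP px].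
  apply/forall_inP => y; rewrite inE => /andP[/eqP oy /eqP py].
  apply/negP => exy; have := edge_col exy => exy'.
  have cxy : col x = col y by lia.
  have [xy] : Some x = Some y by rewrite -px -py cxy.
  by rewrite xy sedge_irrefl in exy.
have cardS : #|S| <= alpha G.
  exact: (@leq_bigmax_cond _ (@independent G) (fun A => #|A|)).
apply: leq_trans cardS; rewrite cardE.
rewrite -(size_map col); apply: uniq_leq_size => // i /sP[oi [x xi]].
case E: [pick y | col y == i] => [y|].
  have yi : col y = i by move: (E); case: pickP => // z /eqP zi [<-].
  by apply/mapP; exists y => //; rewrite mem_enum inE yi oi E !eqxx.
by move: E; case: pickP => // /(_ x); rewrite xi eqxx.
Qed.

Lemma ncols_alpha (s : seq nat) : uniq s ->
  (forall i, i \in s -> exists x, col x = i) -> size s <= 2 * alpha G.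
Proof.
move=> us sP; rewrite -(count_predC odd s) -!size_filter mul2n -addnn.
apply: leq_add; [apply: (@alpha_parity true)|apply: (@alpha_parity false)];
  rewrite ?filter_uniq // => i; rewrite mem_filter /= => /andP[oi /sP ei]; split=> //.
exact: negbTE.
Qed.

End Alpha.

(** The number [k] itself may be large: only labels that occur are counted, one per occupied column
    plus the three special ones. *)
Lemma build_k_expression k (hascol : pred nat) (G : sgraph) (pl : G -> place) (l : seq G) :
  (forall x y, sedge x y = (x != y) && place_adj (pl x) (pl y)) ->
  (forall x, 0 < pcol (pl x) <= k) ->
  (forall x, hascol (pcol (pl x))) ->
  (forall j, hascol j -> exists x, pcol (pl x) = j) ->
  0 < size l -> perm_eq l (enum G) ->
  pairwise (fun x y => ~~ key_lt (key (pl y)) (key (pl x))) l ->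
  exists t, [/\ term (build k hascol (map pl l)) = Some t,
    k_expression (2 * alpha G + 3) t & defines t G].
Proof.
move=> eE cb hE hP l0 lG pw.
have [t [tE wf dt lb]] := build_correct eE cb hE hP l0 lG pw.
exists t; split=> //; rewrite /k_expression wf /=.
pose cols := undup [seq pcol (pl x) | x <- enum G].
apply: (@leq_trans (size (cols ++ [:: 0; k.+1; k.+2]))).
  apply: uniq_leq_size; rewrite ?undup_uniq // => i; rewrite mem_undup mem_cat.
  case/lb=> [->|[x <-]]; first by rewrite orbT.
  by rewrite mem_undup map_f ?mem_enum.
rewrite size_cat leq_add2r; apply: (@ncols_alpha G (pcol \o pl)).
- by move=> x y; rewrite eE /place_adj /place_next /=; lia.
- exact: undup_uniq.
- by move=> i; rewrite mem_undup => /mapP[x _ ->]; exists x.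
Qed.

(** * Word RAM program *)

Definition ends (W : nat) (p : prog) (s : state) (C : nat)
    (Q : state -> Prop) : Prop :=
  exists T s', [/\ run W p s T s', T <= C & Q s'].

(** [step] is split into this side condition and the total function [effect], so that [wp] unfolds
    by computation. *)
Definition fits (W : nat) (i : instr) (s : state) : bool :=
  match i with
  | Const _ c => c <= W
  | Add _ y z => reg s y + reg s z <= W
  | _ => true
  end.

Definition effect (i : instr) (s : state) : state :=
  match i with
  | Const x c => set_reg s x c
  | Add x y z => set_reg s x (reg s y + reg s z)
  | Defs.Sub x y z => set_reg s x (reg s y - reg s z)
  | Get x a y => set_reg s x (arr s a (reg s y))
  | Put a y x => State (reg s)
                   (upd (arr s) a (upd (arr s a) (reg s y) (reg s x))) (out s)
  | Write x => State (reg s) (arr s) (rcons (out s) (reg s x))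
  end.

(* [wp] and [cost] are meant for loop-free programs: their values on [While]
   are junk, and [False] makes [wp] sound. *)
Fixpoint wp (W : nat) (p : prog) (Q : state -> Prop) (s : state) : Prop :=
  match p with
  | Skip => Q s
  | Do i => fits W i s /\ Q (effect i s)
  | Seq p q => wp W p (wp W q Q) s
  | If b p q => if holds b s then wp W p Q s else wp W q Q s
  | While _ _ => False
  end.

Fixpoint cost (p : prog) : nat :=
  match p with
  | Skip => 0
  | Do _ => 1
  | Seq p q => cost p + cost q
  | If _ p q => (maxn (cost p) (cost q)).+1
  | While _ _ => 0
  end.

Section Logic.
Variable W : nat.
Implicit Types (p q : prog) (s : state) (P Q : state -> Prop).

Lemma wp_mono p P Q s : (forall s', P s' -> Q s') -> wp W p P s -> wp W p Q s.
Proof.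
elim: p P Q s => [|i|p IHp q IHq|b p IHp q IHq|b p IHp] //= P Q s PQ.
- exact: PQ.
- by move=> [-> /PQ].
- by apply: IHp => s'; exact: IHq.
- by case: ifP => _; [exact: IHp | exact: IHq].
Qed.

Lemma wp_ends p Q s : wp W p Q s -> ends W p s (cost p) Q.
Proof.
elim: p Q s => [|i|p IHp q IHq|b p IHp q IHq|b p IHp] //= Q s.
- by move=> Qs; exists 0, s; split=> //; constructor.
- move=> [fi Qi]; exists 1, (effect i s); split=> //; constructor.
  by case: i fi {Qi} => //= *; case: ifP => //; lia.
- move=> /IHp[T1 [s1 [r1 l1 /IHq[T2 [s2 [r2 l2 Q2]]]]]].
  exists (T1 + T2), s2; split=> //; last by lia.
  exact: RunSeq r1 r2.
- case: ifP => hb.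
    move=> /IHp[T [s1 [r1 l1 Q1]]]; exists T.+1, s1; split=> //; last by lia.
    exact: RunIfTrue.
  move=> /IHq[T [s1 [r1 l1 Q1]]]; exists T.+1, s1; split=> //; last by lia.
  by apply: RunIfFalse; rewrite ?hb.
Qed.

Lemma ends_seq p q s C D P Q : ends W p s C P ->
  (forall s', P s' -> ends W q s' D Q) -> ends W (Seq p q) s (C + D) Q.
Proof.
move=> [T1 [s1 [r1 l1 P1]]] /(_ _ P1)[T2 [s2 [r2 l2 Q2]]].
exists (T1 + T2), s2; split=> //; last by lia.
exact: RunSeq r1 r2.
Qed.

(** The index of [I] bounds the rounds still to come. A round costs the body and one test; the last
    [1] is the failing test. *)
Lemma ends_while b p (I : nat -> state -> Prop) n s :
  (forall m s', I m s' -> holds b s' ->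
     wp W p (fun s'' => exists2 m', m' < m & I m' s'') s') ->
  I n s ->
  ends W (While b p) s (n * (cost p).+1 + 1)
    (fun s' => ~~ holds b s' /\ exists m, I m s').
Proof.
move=> body; elim/ltn_ind: n s => n IH s In.
have [hb|hb] := boolP (holds b s); last first.
  exists 1, s; split; [exact: RunWhileFalse | by lia |].
  by split=> //; exists n.
have [T1 [s1 [r1 l1 [m mn Im]]]] := wp_ends (body _ _ In hb).
have [T2 [s2 [r2 l2 Q2]]] := IH m mn s1 Im.
exists (T1 + T2).+1, s2; split=> //; first exact: RunWhileTrue hb r1 r2.
have : m.+1 * (cost p).+1 <= n * (cost p).+1 by rewrite leq_mul2r mn orbT.
rewrite mulSn; lia.
Qed.

End Logic.

(** * Linked lists and bucket sort *)

(* Lists are stored as pointers [v.+1] to the vertex [v], 0 being the end. *)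
Fixpoint chain (nx : nat -> nat) (v : nat) (l : seq nat) : Prop :=
  if l is x :: l' then v = x.+1 /\ chain nx (nx x) l' else v = 0.

Lemma chain_upd nx v x y l : x \notin l -> chain nx v l -> chain (upd nx x y) v l.
Proof.
elim: l v => //= z l IH v; rewrite inE negb_or => /andP[xz xl] [-> ch].
by split=> //; rewrite /upd eq_sym (negPf xz); exact: IH.
Qed.

(** Vertices are pushed at the front, hence the reversal. *)
Definition pushed (f : nat -> nat) (L : seq nat) (h nx : nat -> nat) : Prop :=
  forall i, chain nx (h i) (rev [seq v <- L | f v == i]).

(** As [v] is in no list yet, overwriting its successor damages none of them. *)
Lemma pushed_rcons f L h nx v : v \notin L -> pushed f L h nx ->
  pushed f (rcons L v) (upd h (f v) v.+1) (upd nx v (h (f v))).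
Proof.
move=> vL pL i; rewrite filter_rcons.
have vN : v \notin rev [seq u <- L | f u == i].
  by rewrite mem_rev mem_filter (negPf vL) andbF.
rewrite [upd h _ _ i]/upd [i == _]eq_sym.
have [fvi|_] := eqVneq (f v) i; last exact: chain_upd.
rewrite rev_rcons /=; split=> //; rewrite [upd _ _ _ v]/upd eqxx fvi.
exact: chain_upd.
Qed.

Definition buckets (f : nat -> nat) (L : seq nat) (M : nat) : seq nat :=
  flatten [seq rev [seq v <- L | f v == i] | i <- iota 0 M].

Lemma bucketsS f L M :
  buckets f L M.+1 = buckets f L M ++ rev [seq v <- L | f v == M].
Proof. by rewrite /buckets -addn1 iotaD map_cat flatten_cat /= cats0. Qed.

Lemma perm_buckets f L M : {in L, forall v, f v < M} -> perm_eq (buckets f L M) L.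
Proof.
move=> fM; have e : [seq v <- L | f v < M] = L by apply/all_filterP/allP.
rewrite -{2}e; elim: M {fM e} => [|M IH]; first by elim: L.
rewrite bucketsS; apply/permP => a; move/permP/(_ a): IH => IH.
rewrite count_cat IH count_rev; elim: L {IH} => //= v L IH.
have [lt|gt|e] := ltngtP (f v) M.
- by rewrite (leqW lt : f v < M.+1) /=; lia.
- by rewrite ltnNge gt.
- by rewrite e ltnSn /=; lia.
Qed.

Lemma mem_buckets f L M v : v \in buckets f L M -> (v \in L) && (f v < M).
Proof.
elim: M => // M IH; rewrite bucketsS mem_cat mem_rev mem_filter.
by case/orP=> [/IH/andP[-> /leqW ->]|/andP[/eqP<- ->]] //=.
Qed.

Lemma pairwise_rev (T : Type) (r : rel T) s :
  pairwise r (rev s) = pairwise (fun x y => r y x) s.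
Proof.
elim: s => //= x s IH; rewrite rev_cons -cats1 pairwise_cat IH /= andbT.
by rewrite allrel1r all_rev.
Qed.

(** A pass reverses the elements of equal key, which is why [r] is used in the form [r v u]. *)
Lemma pairwise_buckets f L M (r q : rel nat) : pairwise r L ->
  {in L &, forall u v, f u < f v -> q u v} ->
  {in L &, forall u v, f u = f v -> r v u -> q u v} ->
  pairwise q (buckets f L M).
Proof.
move=> rL q1 q2; elim: M => // M IH; rewrite bucketsS pairwise_cat IH /=.
apply/andP; split.
  apply/allrelP => u v /mem_buckets/andP[uL fu].
  rewrite mem_rev mem_filter => /andP[/eqP fv vL]; apply: q1 => //; lia.
rewrite pairwise_rev; have {}rL := pairwise_filter (fun v => f v == M) rL.
apply: (sub_in_pairwise (P := mem [seq v <- L | f v == M])) rL; last exact/allP.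
move=> u v; rewrite !mem_filter => /andP[/eqP fu uL] /andP[/eqP fv vL].
by apply: q2 => //; rewrite fu.
Qed.

(** * Traversal of the buckets *)

Definition seqs : seq prog -> prog := foldr Seq Skip.

Lemma wp_seqs W p ps Q s :
  wp W (seqs (p :: ps)) Q s = wp W p (wp W (seqs ps) Q) s.
Proof. by []. Qed.

(* Register 2 holds the number of buckets, registers 3 and 4 the constants 0
   and 1; the loop runs once per bucket and once per vertex. *)
Definition traverse_body (H Nx : nat) (body : prog) : prog :=
  If (Eq 6 3)
     (seqs [:: Do (Add 5 5 4); Do (Get 6 H 5)])
     (seqs [:: Do (Defs.Sub 7 6 4); Do (Get 6 Nx 7); body]).

Definition traverse (H Nx : nat) (body : prog) : prog :=
  Seq (seqs [:: Do (Defs.Sub 5 3 3); Do (Get 6 H 5)])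
      (While (Lt 5 2) (traverse_body H Nx body)).

Section Traverse.
Variables (W H Nx M : nat) (body : prog) (f : nat -> nat) (L : seq nat).
Variables (h nx : nat -> nat) (Inv : seq nat -> state -> Prop).
Hypothesis MW : M <= W.
Hypothesis M0 : 0 < M.
Hypothesis hnx : pushed f L h nx.
Hypothesis Inv_fixed : forall vis s, Inv vis s ->
  [/\ reg s 2 = M, reg s 3 = 0, reg s 4 = 1, arr s H = h & arr s Nx = nx].
Hypothesis Inv_local : forall vis s x v, 5 <= x <= 7 ->
  Inv vis s -> Inv vis (set_reg s x v).
Hypothesis Inv_body : forall vis v tl s, buckets f L M = vis ++ v :: tl ->
  Inv vis s -> reg s 7 = v ->
  wp W body (fun s' => [/\ Inv (rcons vis v) s', reg s' 5 = reg s 5 &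
                           reg s' 6 = reg s 6]) s.

(** [rest] is the unread part of bucket [reg s 5], and [m] counts unread vertices plus remaining
    buckets. Once that register reaches [M], the pointer was read past the last bucket and means
    nothing, whence the second alternative. *)
Let loop_inv (m : nat) (s : state) : Prop :=
  exists vis rest, [/\ Inv vis s, reg s 5 <= M, chain nx (reg s 6) rest \/ reg s 5 = M,
    buckets f L M = vis ++ rest ++
      flatten [seq rev [seq v <- L | f v == i] | i <- iota (reg s 5).+1 (M - (reg s 5).+1)] &
    (reg s 5 = M -> rest = [::]) /\
    m = (size (buckets f L M) - size vis) + (M - reg s 5)].

Lemma traverse_ends s : Inv [::] s ->
  ends W (traverse H Nx body) s
    ((size (buckets f L M) + M) * (cost body + 4) + 3) (Inv (buckets f L M)).
Proof.
move=> I0; pose n := size (buckets f L M) + M.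
have step1 : wp W (seqs [:: Do (Defs.Sub 5 3 3); Do (Get 6 H 5)]) (loop_inv n) s.
  have [r2 r3 r4 aH aN] := Inv_fixed I0.
  do 2![split=> //]; exists [::], (rev [seq v <- L | f v == 0]).
  split; first by do 2![apply: Inv_local => //].
  - by rewrite /= /upd /= r3.
  - by left; rewrite /= /upd /= r3 aH.
  - rewrite /= /upd /= r3 subnn; case: M M0 => // m _.
    by rewrite /buckets /= subSS subn0.
  - by rewrite /= /upd /= r3 subnn; split; [lia | rewrite !subn0].
have := ends_seq (wp_ends step1); rewrite /traverse => tr.
(* A round takes at most the branching, two instructions, the body and the loop test; the final [3]
   is two initial instructions and the failing test. *)
have -> : n * (cost body + 4) + 3 = cost (seqs [:: Do (Defs.Sub 5 3 3); Do (Get 6 H 5)]) +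
    (n * (cost (traverse_body H Nx body)).+1 + 1).
  have -> : cost (traverse_body H Nx body) = cost body + 3 by rewrite /=; lia.
  by rewrite /= -addnS; lia.
apply: tr => s1 /(ends_while _) lw; have [|T [s' [r l [hb [m inv]]]]] := lw W (Lt 5 2) (traverse_body H Nx body).
  move=> {lw s1 step1 s I0} m s [vis [rest [I jM ch e [jr me]]]] /=.
  have [r2 r3 r4 aH aN] := Inv_fixed I.
  rewrite r2 r3 => jlt.
  have {}ch : chain nx (reg s 6) rest by case: ch => // ej; rewrite ej ltnn in jlt.
  case: eqP => v0.
    have rest0 : rest = [::] by case: rest ch {e jr} => //= v rest [e]; rewrite e in v0.
    subst rest; split; first by rewrite r4; lia.
    split=> //; exists ((size (buckets f L M) - size vis) + (M - (reg s 5).+1)).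
      by lia.
    have e1 : M - (reg s 5).+1 = if (reg s 5).+1 == M then 0 else (M - (reg s 5).+2).+1.
      by case: eqP; lia.
    exists vis, (if (reg s 5).+1 == M then [::] else rev [seq v <- L | f v == (reg s 5).+1]).
    split; rewrite /= /upd /= ?r4 ?addn1 //.
    - by do 2![apply: Inv_local => //].
    - by case: eqP; [right | left; rewrite aH].
    - rewrite e e1; case: eqP => [->|_] /=; first by rewrite (_ : M - M.+1 = 0) //; lia.
      by [].
    - by split=> // ->; rewrite eqxx.
  case: rest ch e jr => [|v rest] //= [v1 ch] e jr.
  do 2![split=> //]; set s1 := set_reg (set_reg _ _ _) _ _.
  have I1 : Inv vis s1 by do 2![apply: Inv_local => //].
  have s17 : reg s1 7 = v by rewrite /= /upd /= v1 r4; lia.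
  apply: wp_mono (Inv_body e I1 s17) => s2 [I2 s25 s26].
  have s15 : reg s1 5 = reg s 5 by [].
  have s16 : reg s1 6 = nx v by rewrite /= /upd /= aN v1 r4 subn1.
  exists ((size (buckets f L M) - (size vis).+1) + (M - reg s 5)).
    by rewrite me e size_cat /=; lia.
  exists (rcons vis v), rest; rewrite s25 s15 s26 s16; split=> //.
  - by left.
  - by rewrite cat_rcons.
  - by rewrite size_rcons; split=> // ej; rewrite ej ltnn in jlt.
exists T, s'; split=> //; case: inv => vis [rest [I jM ch e [jr me]]].
have [r2 r3 r4 aH aN] := Inv_fixed I.
have ej : reg s' 5 = M by move: hb; rewrite /= r2; lia.
move: e; rewrite jr // ej (_ : M - M.+1 = 0) /=; last by lia.
by rewrite cats0 => ->.
Qed.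
End Traverse.

(* Registers: 5-9 are those of [traverse] and [push], 10 and 11 the labels
   [k.+1] and [k.+2], 12 and 13 the opcodes 2 and 3, 14-17 the previous and the
   current bubble, 18-21 the place of the current vertex, 22 is 0 before the
   first vertex.  Copies are written [x := y - 0] since [Add] needs a bound.
   Arrays 5-6 and 7-8 hold the vertices by column, from right to left, and by
   row. *)
Definition push (H Nx : nat) : prog :=
  seqs [:: Do (Get 9 H 8); Do (Put Nx 7 9); Do (Add 9 7 4); Do (Put H 8 9)].

Definition emit (a b c : nat) : prog :=
  seqs [:: Do (Write a); Do (Write b); Do (Write c)].

Definition load_prog : prog :=
  seqs [:: Do (Get 18 0 7); Do (Get 19 1 7); Do (Get 20 2 7); Do (Get 21 3 7)].

Definition flush_prog : prog :=
  seqs [:: emit 12 10 15; emit 12 11 10; Do (Defs.Sub 14 16 3);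
           Do (Defs.Sub 15 17 3); Do (Defs.Sub 16 18 3); Do (Defs.Sub 17 19 3)].

(** Registers 3 and 4 hold 0 and 1, so [emit 3 3 4] outputs [Vertex 0] followed by the opcode of
    [Union]. The code is postfix, so [flush_prog] emits the inner relabelling first. *)
Definition enter_prog : prog :=
  If (Eq 22 3)
    (seqs [:: Do (Defs.Sub 14 18 3); Do (Defs.Sub 15 19 3);
              Do (Defs.Sub 16 18 3); Do (Defs.Sub 17 19 3);
              Do (Defs.Sub 22 4 3); Do (Write 3); Do (Write 3)])
    (Seq (If (Eq 18 16) (If (Eq 19 17) Skip flush_prog) flush_prog)
         (emit 3 3 4)).

Definition joins_prog : prog :=
  seqs [:: emit 13 3 19; Do (Add 23 19 4);
           If (Lt 19 1) (emit 13 3 23) Skip; emit 13 3 11].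

Definition prev_prog : prog :=
  seqs [:: Do (Add 23 19 4); Do (Defs.Sub 24 19 4);
    If (Eq 15 19) (emit 13 3 10)
      (If (Eq 15 23) (emit 13 3 10)
        (If (Eq 15 24)
          (If (Eq 14 18) (If (Eq 20 4) (emit 13 3 10) Skip) Skip) Skip))].

Definition relabel_prog : prog :=
  If (Eq 21 4) (emit 12 3 11) (emit 12 3 19).

Definition place_prog : prog :=
  seqs [:: load_prog; enter_prog; joins_prog; prev_prog; relabel_prog].

Definition setup_prog : prog :=
  seqs [:: Do (Const 4 1); Do (Add 2 0 4); Do (Const 12 2); Do (Const 13 3);
           Do (Add 10 1 4); Do (Add 11 10 4)].

Definition column_prog : prog :=
  seqs [:: Do (Get 8 1 7); Do (Defs.Sub 8 1 8); push 5 6; Do (Add 7 7 4)].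

Definition row_prog : prog := Seq (Do (Get 8 0 7)) (push 7 8).

Definition expression_prog : prog :=
  seqs [:: setup_prog; While (Lt 7 0) column_prog;
           traverse 5 6 row_prog; traverse 7 8 place_prog].

(** * Correctness and running time of the program *)

Section Program.
Variables (W n k : nat) (l : seq place).
Hypothesis kn : k <= n.
Let d := Place 0 0 false false.
Let pl (v : nat) := nth d l v.
Hypothesis col_bound : forall v, v < n -> 0 < pcol (pl v) <= k.
Hypothesis row_bound : forall v, v < n -> prow (pl v) <= n.

(** Columns are sorted in decreasing order because the pass by rows reverses ties. *)
Definition column_key (v : nat) : nat := k - pcol (pl v).
Definition row_key (v : nat) : nat := prow (pl v).
(** Column and row keys lie between [0] and [n], hence [n.+1] buckets. *)
Definition by_column : seq nat := buckets column_key (iota 0 n) n.+1.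
Definition by_row : seq nat := buckets row_key by_column n.+1.

Lemma perm_by_column : perm_eq by_column (iota 0 n).
Proof. by apply: perm_buckets => v _; rewrite /column_key; lia. Qed.

Lemma perm_by_row : perm_eq by_row (iota 0 n).
Proof.
apply: perm_trans perm_by_column; apply: perm_buckets => v.
by rewrite (perm_mem perm_by_column) mem_iota ltnS => /row_bound.
Qed.

Lemma pairwise_by_row :
  pairwise (fun u v => ~~ key_lt (key (pl v)) (key (pl u))) by_row.
Proof.
have colL v : v \in by_column -> pcol (pl v) <= k.
  by rewrite (perm_mem perm_by_column) mem_iota => /col_bound/andP[].
apply: (@pairwise_buckets _ _ _ (fun u v => column_key u <= column_key v)).
- apply: (@pairwise_buckets _ _ _ (fun _ _ => true)) => [|u v _ _ /ltnW //|u v _ _ -> //].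
  by apply: (introT (pairwiseP 0)).
- by move=> u v _ _; rewrite /row_key /key_lt /=; lia.
- move=> u v /colL cu /colL cv; rewrite /row_key /column_key /key_lt /=; lia.
Qed.

(** The program creates no value above the larger of [n + 2], which bounds [k.+2], and the opcode
    [3]. *)
Hypothesis nW : n + 3 <= W.

Definition fixed_data (s : state) : Prop :=
  [/\ [/\ reg s 0 = n, reg s 1 = k, reg s 2 = n.+1, reg s 3 = 0 & reg s 4 = 1],
      [/\ reg s 10 = k.+1, reg s 11 = k.+2, reg s 12 = 2 & reg s 13 = 3] &
      [/\ forall v, v < n -> arr s 0 v = prow (pl v),
          forall v, v < n -> arr s 1 v = pcol (pl v),
          forall v, v < n -> arr s 2 v = psign1 (pl v) &
          forall v, v < n -> arr s 3 v = psign2 (pl v)]].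

Lemma fixed_data_frame s s' :
  {in [:: 0; 1; 2; 3; 4; 10; 11; 12; 13], reg s' =1 reg s} ->
  {in [:: 0; 1; 2; 3], forall a, arr s' a = arr s a} ->
  fixed_data s -> fixed_data s'.
Proof. by move=> rE aE; rewrite /fixed_data !rE // !aE. Qed.

(** Registers 23 and 24 are scratch space of the emitting programs. *)
Definition writes (s : state) (o : seq nat) (s' : state) : Prop :=
  [/\ out s' = out s ++ o, arr s' = arr s & forall x, x < 23 -> reg s' x = reg s x].

Lemma writes_trans s1 s2 s3 o1 o2 :
  writes s1 o1 s2 -> writes s2 o2 s3 -> writes s1 (o1 ++ o2) s3.
Proof.
move=> [e1 a1 r1] [e2 a2 r2]; split; [by rewrite e2 e1 catA|by rewrite a2|].
by move=> x xl; rewrite r2 // r1.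
Qed.

Lemma writes_fixed s o s' : writes s o s' -> fixed_data s -> fixed_data s'.
Proof.
move=> [_ aE rE]; apply: fixed_data_frame => [x|a _]; last by rewrite aE.
by move=> xl; apply: rE; move: xl; rewrite !inE; lia.
Qed.

Ltac solve_writes :=
  do ?[split=> //]; first [ by rewrite /= ?cats0 -?cats1 -?catA ?addn1
    | by move=> x xl; rewrite /= /upd; do ?[case: eqP => //]; lia ].

Definition loaded (p : place) (s : state) : Prop :=
  [/\ reg s 18 = prow p, reg s 19 = pcol p, reg s 20 = psign1 p &
      reg s 21 = psign2 p].

Lemma joins_prog_wp s p : fixed_data s -> loaded p s -> pcol p <= k ->
  wp W joins_prog (writes s ([:: 3; 0; pcol p] ++
    (if pcol p < k then [:: 3; 0; (pcol p).+1] else [::]) ++ [:: 3; 0; k.+2])) s.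
Proof.
move=> [[r0 r1 r2 r3 r4] [r10 r11 r12 r13] _] [r18 r19 r20 r21] ck.
rewrite /= /upd /= !(r1, r3, r4, r11, r13, r19).
have fit : pcol p + 1 <= W by lia.
by case: (_ < k); solve_writes.
Qed.

Lemma prev_prog_wp s p : fixed_data s -> loaded p s -> 0 < pcol p <= k ->
  wp W prev_prog (writes s
    (if joins_prev (reg s 14, reg s 15) p then [:: 3; 0; k.+1] else [::])) s.
Proof.
move=> [[r0 r1 r2 r3 r4] [r10 r11 r12 r13] _] [r18 r19 r20 r21] ck.
rewrite /= /upd /= !(r1, r3, r4, r10, r13, r18, r19, r20) /joins_prev /= addn1.
(* Truncated subtraction is exact here because [pcol p] is positive. *)
have -> : (reg s 15 == pcol p - 1) = ((reg s 15).+1 == pcol p) by lia.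
have fit : pcol p + 1 <= W by lia.
rewrite (addn1 (pcol p)) in fit.
by case: (reg s 15 == _); [|case: (reg s 15 == _); [|
  case: (_ == pcol p); [case: (_ == prow p); [case: (psign1 p)|]|]]]; solve_writes.
Qed.

Lemma relabel_prog_wp s p : fixed_data s -> loaded p s ->
  wp W relabel_prog
    (writes s [:: 2; 0; if psign2 p then k.+2 else pcol p]) s.
Proof.
move=> [[r0 r1 r2 r3 r4] [r10 r11 r12 r13] _] [r18 r19 r20 r21].
rewrite /= /upd /= !(r3, r4, r11, r12, r19, r21).
by case: (psign2 p); solve_writes.
Qed.

Definition term_code (o : option cwterm) : seq nat :=
  if o is Some t then code t else [::].

Definition tracks (st : builder) (s : state) : Prop :=
  reg s 22 = isSome (term st) /\
  (isSome (term st) ->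
   [/\ (prev_bubble st).1 = reg s 14, (prev_bubble st).2 = reg s 15,
       (cur_bubble st).1 = reg s 16 & (cur_bubble st).2 = reg s 17]).

Ltac solve_frame :=
  do ?[split=> //]; first [ by rewrite /= -?cats1 -?catA ?addn1
    | by move=> x xl; rewrite /= /upd; do ?[case: eqP => //]; lia
    | by rewrite /= ?subn0 ].

Lemma enter_prog_wp s p st : fixed_data s -> loaded p s -> tracks st s ->
  out s = term_code (term st) ->
  wp W enter_prog (fun s' =>
    [/\ out s' = code (add_vertex (term (enter k st p))), arr s' = arr s,
        forall x, x < 14 -> reg s' x = reg s x, loaded p s' &
        [/\ reg s' 22 = 1, prev_bubble (enter k st p) = (reg s' 14, reg s' 15) &
            cur_bubble (enter k st p) = (reg s' 16, reg s' 17)]]) s.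
Proof.
case: st => o [pr pc] [qr qc].
move=> [[r0 r1 r2 r3 r4] [r10 r11 r12 r13] _] [r18 r19 r20 r21] [/= r22 rpq] oE.
rewrite /= /upd /= !(r3, r4, r10, r11, r12, r18, r19, r22) /enter /key /=.
case: o r22 rpq oE => [t|] /= r22 rpq oE; last by rewrite oE; solve_frame.
have [-> -> -> ->] := rpq isT; rewrite xpair_eqE oE /=.
case: (_ == reg s 16); last by solve_frame.
by case: (_ == reg s 17); solve_frame.
Qed.

(** All columns of a bubble model are occupied, so the guard of [add_place] becomes a comparison. *)
Definition model_col (j : nat) : bool := 0 < j <= k.

Definition place_inv (h nx : nat -> nat) (vis : seq nat) (s : state) : Prop :=
  let st := build k model_col (map pl vis) in
  [/\ fixed_data s, arr s 7 = h, arr s 8 = nx, tracks st s &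
      out s = term_code (term st)].

Lemma load_prog_wp s v : fixed_data s -> reg s 7 = v -> v < n ->
  wp W load_prog (fun s' => [/\ out s' = out s, arr s' = arr s,
    loaded (pl v) s' & forall x, (x < 18) || (x == 22) -> reg s' x = reg s x]) s.
Proof.
move=> [_ _ [a0 a1 a2 a3]] r7 vn.
rewrite /= /upd /= r7 a0 // a1 // a2 // a3 //; solve_frame.
Qed.

Lemma code_join_if b i j t :
  code (join_if b i j t) = code t ++ if b then [:: 3; i; j] else [::].
Proof. by case: b; rewrite /= ?cats0. Qed.

Lemma place_prog_wp h nx vis s v : v < n -> place_inv h nx vis s -> reg s 7 = v ->
  wp W place_prog (fun s' => [/\ place_inv h nx (rcons vis v) s',
    reg s' 5 = reg s 5 & reg s' 6 = reg s 6]) s.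
Proof.
move=> vn [fs a7 a8 tr oE] r7; rewrite /place_prog.
have cv := col_bound vn; have /andP[_ ck] := cv.
rewrite wp_seqs; apply: wp_mono (load_prog_wp fs r7 vn) => s1 [o1 A1 l1 R1].
have f1 : fixed_data s1.
  apply: fixed_data_frame fs => [x xl|a _]; last by rewrite A1.
  by apply: R1; move: xl; rewrite !inE; lia.
have t1 : tracks (build k model_col (map pl vis)) s1.
  by move: tr; rewrite /tracks !R1.
rewrite wp_seqs; apply: wp_mono (enter_prog_wp f1 l1 t1 _) => [s2 [o2 A2 R2 l2]|]; last first.
  by rewrite o1.
move: o2; set st' := enter _ _ _ => o2 [r22 pE cE].
have f2 : fixed_data s2.
  apply: fixed_data_frame f1 => [x xl|a _]; last by rewrite A2.
  by apply: R2; move: xl; rewrite !inE; lia.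
rewrite wp_seqs; apply: wp_mono (joins_prog_wp f2 l2 ck) => s3 w3.
have ld3 s' o : writes s2 o s' -> loaded (pl v) s'.
  by move=> [_ _ R]; move: l2; rewrite /loaded !R.
have f3 := writes_fixed w3 f2; have l3 := ld3 _ _ w3.
rewrite wp_seqs; apply: wp_mono (prev_prog_wp f3 l3 cv) => s4 w4.
have {w4}w4 := writes_trans w3 w4.
have f4 := writes_fixed w4 f2; have l4 := ld3 _ _ w4.
rewrite wp_seqs; apply: wp_mono (relabel_prog_wp f4 l4) => s5 w5.
have {w5}w5 := writes_trans w4 w5.
have f5 := writes_fixed w5 f2.
have R3 : (reg s3 14, reg s3 15) = prev_bubble st' by case: w3 => _ _ R; rewrite !R.
case: w5 => o5 A5 R5 /=; split;
  [|by rewrite R5 // R2 // R1|by rewrite R5 // R2 // R1].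
rewrite /place_inv /build map_rcons foldl_rcons -/(build k model_col (map pl vis)).
rewrite /add_place -/st' /=; split=> //.
- by rewrite A5 A2 A1.
- by rewrite A5 A2 A1.
- by split; rewrite /= ?R5 // => _; rewrite pE cE.
- rewrite o5 o2 R3 /= !(code_join_if, =^~ catA) /=.
  have -> : model_col (pcol (pl v)).+1 = (pcol (pl v) < k) by [].
  by case: (_ < k) => /=; rewrite -!catA.
Qed.

Definition row_inv (h nx : nat -> nat) (vis : seq nat) (s : state) : Prop :=
  [/\ fixed_data s, arr s 5 = h, arr s 6 = nx,
      pushed row_key vis (arr s 7) (arr s 8) & out s = [::] /\ reg s 22 = 0].

Lemma row_prog_wp h nx vis s v : v < n -> v \notin vis -> row_inv h nx vis s ->
  reg s 7 = v ->
  wp W row_prog (fun s' => [/\ row_inv h nx (rcons vis v) s',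
    reg s' 5 = reg s 5 & reg s' 6 = reg s 6]) s.
Proof.
move=> vn vvis [fs a5 a6 pv [oE r22]] r7.
have [[_ _ _ _ r4] _ [a0 _ _ _]] := fs.
have pv' := pushed_rcons vvis pv.
rewrite /= /upd /= r7 r4 a0 // addn1; do 3![split=> //].
split; first by lia.
by do 3![split=> //].
Qed.

Definition column_inv (m : nat) (s : state) : Prop :=
  [/\ fixed_data s, pushed column_key (iota 0 (reg s 7)) (arr s 5) (arr s 6),
      arr s 7 = (fun=> 0) & [/\ out s = [::], reg s 22 = 0, reg s 7 <= n &
      m = n - reg s 7]].

Lemma column_prog_wp m s : column_inv m s -> holds (Lt 7 0) s ->
  wp W column_prog (fun s' => exists2 m', m' < m & column_inv m' s') s.
Proof.
move=> [fs pv a7 [oE r22 r7n ->]]; rewrite /holds.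
have [[r0 r1 _ _ r4] _ [_ a1 _ _]] := fs; rewrite r0 => vn.
have vN : reg s 7 \notin iota 0 (reg s 7) by rewrite mem_iota ltnn.
have := pushed_rcons vN pv; rewrite -cats1 -(iotaD 0 _ 1) addn1 => pv'.
rewrite /= /upd /= r4 r1 a1 // addn1.
do 4![split=> //]; split; first by lia.
do 2![split=> //]; first by lia.
exists (n - (reg s 7).+1); first by lia.
by [].
Qed.

Lemma expression_prog_ends s :
  [/\ reg s 0 = n, reg s 1 = k, reg s 3 = 0, reg s 7 = 0 & reg s 22 = 0] ->
  [/\ forall v, v < n -> arr s 0 v = prow (pl v),
      forall v, v < n -> arr s 1 v = pcol (pl v),
      forall v, v < n -> arr s 2 v = psign1 (pl v) &
      forall v, v < n -> arr s 3 v = psign2 (pl v)] ->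
  [/\ arr s 5 = (fun=> 0), arr s 7 = (fun=> 0) & out s = [::]] ->
  ends W expression_prog s (200 * n + 100)
    (fun s' => out s' = term_code (term (build k model_col (map pl by_row)))).
Proof.
move=> [r0 r1 r3 r7 r22] [a0 a1 a2 a3] [a5 a7 oE].
have size1 : size by_column = n by rewrite (perm_size perm_by_column) size_iota.
have size2 : size by_row = n by rewrite (perm_size perm_by_row) size_iota.
have setup : wp W setup_prog (column_inv n) s.
  rewrite /= /upd /= r0 r1 !addn1.
  do 6?[split; first by [|lia]].
  split=> //=; first by rewrite /upd /= r7 => i; rewrite a5.
  by rewrite /upd /= r7 subn0.
have col s1 : column_inv n s1 -> ends W (While (Lt 7 0) column_prog) s1 (n * 8 + 1)
    (fun s2 => row_inv (arr s2 5) (arr s2 6) [::] s2 /\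
               pushed column_key (iota 0 n) (arr s2 5) (arr s2 6)).
  move=> I1; have [T [s2 [r le [hb [m []]]]]] := ends_while column_prog_wp I1.
  move=> f2 p2 a27 [o2 r222 r27 _]; exists T, s2; split=> //.
  have e7 : reg s2 7 = n by move: hb; rewrite /=; case: f2 => [[-> _ _ _ _] _ _]; lia.
  rewrite e7 in p2; split=> //; split=> // i; by rewrite /= a27.
have row s2 : row_inv (arr s2 5) (arr s2 6) [::] s2 /\
      pushed column_key (iota 0 n) (arr s2 5) (arr s2 6) ->
    ends W (traverse 5 6 row_prog) s2 ((n + n.+1) * 9 + 3)
      (fun s3 => place_inv (arr s3 7) (arr s3 8) [::] s3 /\
                 pushed row_key by_column (arr s3 7) (arr s3 8)).
  move=> [I2 p2].
  have [|||||T [s3 [r le [f3 _ _ p3 [o3 r223]]]]] :=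
    @traverse_ends W 5 6 n.+1 row_prog column_key (iota 0 n) (arr s2 5) (arr s2 6)
      (row_inv (arr s2 5) (arr s2 6)) _ _ p2 _ _ _ s2 I2.
  - by lia.
  - by [].
  - by move=> vis s' [[[_ _ r2' r3' r4'] _ _] a5' a6' _ _].
  - move=> vis s' x v xl [f' a5' a6' p' [o' r22']]; split=> //.
      apply: fixed_data_frame f' => // y; rewrite !inE /= /upd => yl.
      by case: eqP => // yx; move: yl; lia.
    by split=> //=; rewrite /upd; case: eqP => //; lia.
  - move=> vis v tl s' e I' r7'; apply: row_prog_wp I' r7'.
      have : v \in by_column by rewrite /by_column e mem_cat mem_head orbT.
      by rewrite (perm_mem perm_by_column) mem_iota.
    have := iota_uniq 0 n; rewrite -(perm_uniq perm_by_column) /by_column e.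
    by rewrite cat_uniq /= => /and3P[_ /norP[]].
  exists T, s3; split=> //; last by rewrite -/by_column size1 in le.
have fin s3 : place_inv (arr s3 7) (arr s3 8) [::] s3 /\
      pushed row_key by_column (arr s3 7) (arr s3 8) ->
    ends W (traverse 7 8 place_prog) s3 ((n + n.+1) * (cost place_prog + 4) + 3)
      (fun s' => out s' = term_code (term (build k model_col (map pl by_row)))).
  move=> [I3 p3].
  have [|||||T [s' [r le [_ _ _ _ o']]]] :=
    @traverse_ends W 7 8 n.+1 place_prog row_key by_column (arr s3 7) (arr s3 8)
      (place_inv (arr s3 7) (arr s3 8)) _ _ p3 _ _ _ s3 I3.
  - by lia.
  - by [].
  - by move=> vis s' [[[_ _ r2' r3' r4'] _ _] a7' a8' _ _].
  - move=> vis s' x v xl [f' a7' a8' [r22' t'] o']; split=> //.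
      apply: fixed_data_frame f' => // y; rewrite !inE /= /upd => yl.
      by case: eqP => // yx; move: yl; lia.
    have R y : 13 < y -> reg (set_reg s' x v) y = reg s' y.
      by move=> ly; rewrite /= /upd; case: eqP => //; lia.
    by split; rewrite !R.
  - move=> vis v tl s' e I' r7'; apply: place_prog_wp I' r7'.
    have : v \in by_row by rewrite /by_row e mem_cat mem_head orbT.
    by rewrite (perm_mem perm_by_row) mem_iota.
  exists T, s'; split=> //; last by rewrite -/by_row size2 in le.
have skip s' : out s' = term_code (term (build k model_col (map pl by_row))) ->
    ends W (seqs [::]) s' 0 (fun s' => out s' =
      term_code (term (build k model_col (map pl by_row)))) .
  by move=> o'; exists 0, s'; split=> //; exact: RunSkip.
have [T [s' [r le o]]] := ends_seq (wp_ends setup) (fun s1 h1 =>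
  ends_seq (col s1 h1) (fun s2 h2 => ends_seq (row s2 h2) (fun s3 h3 =>
  ends_seq (fin s3 h3) skip))).
(* The costs add up to [124 * n + 71]. *)
exists T, s'; split=> //; apply: leq_trans le _ => /=; lia.
Qed.
End Program.

(** * Bubble models *)

Section BubbleModel.
Variables (A : finType) (B : bubble_structure A) (w : A -> place).
Hypothesis wP : forall x, x \in quadrant B (prow (w x)) (pcol (w x))
                                          (psign1 (w x)) (psign2 (w x)).

Lemma in_quadrant x i j s t : (x \in quadrant B i j s t) =
  [&& i == prow (w x), j == pcol (w x), s == psign1 (w x) & t == psign2 (w x)].
Proof.
apply/idP/and4P => [xq|[/eqP-> /eqP-> /eqP-> /eqP->]]; last exact: wP.
by have [-> -> -> ->] := quadrant_disjoint xq (wP x).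
Qed.

Lemma in_bubble x i j :
  (x \in bubble B i j) = (i == prow (w x)) && (j == pcol (w x)).
Proof.
rewrite /bubble !inE !in_quadrant.
by case: (i == _); case: (j == _); case: (psign1 _); case: (psign2 _).
Qed.

Lemma in_bubble_xp x i j : (x \in bubble_xp B i j) =
  [&& i == prow (w x), j == pcol (w x) & psign2 (w x)].
Proof.
rewrite /bubble_xp !inE !in_quadrant.
by case: (i == _); case: (j == _); case: (psign1 _); case: (psign2 _).
Qed.

Lemma in_bubble_px x i j : (x \in bubble_px B i j) =
  [&& i == prow (w x), j == pcol (w x) & psign1 (w x)].
Proof.
rewrite /bubble_px !inE !in_quadrant.
by case: (i == _); case: (j == _); case: (psign1 _); case: (psign2 _).
Qed.

Lemma bubble_adj_orderedP u v : bubble_adj_ordered B u v <->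
  (pcol (w u) == pcol (w v)) || place_next (w u) (w v).
Proof.
split.
- move=> [i [j [i' [j' []]]]]; rewrite !in_bubble.
  move=> /andP[/eqP-> /eqP->] /andP[/eqP-> /eqP->].
  rewrite in_bubble_xp in_bubble_px /place_next.
  case=> [->|[<- ->]|[<- -> /and3P[_ _ ->] /and3P[_ _ ->]]]; by rewrite !eqxx ?orbT.
- move=> h; exists (prow (w u)), (pcol (w u)), (prow (w v)), (pcol (w v)).
  rewrite !in_bubble in_bubble_xp in_bubble_px !eqxx /=; split=> //.
  case/orP: h => [/eqP|]; first by constructor 1.
  move=> /andP[/eqP <-] /orP[lt|/and3P[/eqP-> -> ->]]; first by constructor 2.
  by constructor 3.
Qed.

Lemma bubble_adjP u v : bubble_adj B u v <-> u <> v /\ place_adj (w u) (w v).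
Proof.
have symE : place_adj (w u) (w v) = ((pcol (w u) == pcol (w v)) || place_next (w u) (w v))
    || ((pcol (w v) == pcol (w u)) || place_next (w v) (w u)).
  by rewrite /place_adj [pcol (w v) == _]eq_sym; case: (pcol _ == _).
rewrite /bubble_adj symE; split=> -[uv h]; split=> //.
  by case: h => /bubble_adj_orderedP ->; rewrite ?orbT.
by case/orP: h => /bubble_adj_orderedP; [left | right].
Qed.

Lemma place_index x :
  (0 < pcol (w x) <= ncols B) && (0 < prow (w x) <= nrows B (pcol (w x))).
Proof. exact: quadrant_index (wP x). Qed.

Lemma row_le_card x :
  (forall i j, 1 <= j <= ncols B -> 1 <= i <= nrows B j ->
     exists j', bubble B i j' != set0) -> prow (w x) <= #|A|.
Proof.
move=> rows; have /andP[cx rx] := place_index x.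
rewrite -(size_iota 1 (prow (w x))) cardE -(size_map (prow \o w)).
apply: uniq_leq_size; first exact: iota_uniq.
move=> i; rewrite mem_iota => ib.
have [|j' /set0Pn[y]] := rows i _ cx; first by lia.
by rewrite in_bubble => /andP[/eqP-> _]; apply/mapP; exists y; rewrite ?mem_enum.
Qed.

Lemma ncols_le_card :
  (forall j, 1 <= j <= ncols B -> exists x, pcol (w x) = j) -> ncols B <= #|A|.
Proof.
move=> cols; rewrite -(size_iota 1 (ncols B)) cardE -(size_map (pcol \o w)).
apply: uniq_leq_size; first exact: iota_uniq.
move=> j; rewrite mem_iota => jb; have [|x <-] := cols j; first by lia.
by apply/mapP; exists x; rewrite ?mem_enum.
Qed.

End BubbleModel.

Lemma expression_prog_correct (G : sgraph) (B : bubble_structure G)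
    (l : seq place) : bubble_model B -> listing B l ->
  exists (t : cwterm) (T : nat) (s : state),
    [/\ run (300 * #|G|) expression_prog (init B l) T s, T <= 300 * #|G|,
        out s = code t, k_expression (2 * alpha G + 3) t & defines t G].
Proof.
move=> [[f [[g fK gK] fE]] [colsB rowsB _ _ _]] [e [w [eG wP lE]]].
have n0 := bubble_carrier B.
have [x0 _] : exists x : G, x \in G by apply/card_gt0P.
have cols j : 1 <= j <= ncols B -> exists x, pcol (w x) = j.
  move=> /colsB[i /set0Pn[x]]; rewrite (in_bubble wP) => /andP[_ /eqP->].
  by exists x.
have kn := ncols_le_card cols.
have size_e : size e = #|G| by rewrite (perm_size eG) -cardE.
have sizel : size l = #|G| by rewrite lE size_map.
pose d := Place 0 0 false false.
have plE v : v < #|G| -> nth d l v = w (nth x0 e v).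
  by move=> vn; rewrite lE (nth_map x0) // size_e.
have cb v : v < #|G| -> 0 < pcol (nth d l v) <= ncols B.
  by move=> vn; rewrite plE //; have /andP[] := place_index wP (nth x0 e v).
have rb v : v < #|G| -> prow (nth d l v) <= #|G|.
  by move=> vn; rewrite plE //; apply: row_le_card rowsB.
(* The carrier is nonempty, so the factor [300] absorbs additive constants, here and in the time
   bound. *)
have nW : #|G| + 3 <= 300 * #|G| by lia.
have [|||T [s [r le oE]]] := @expression_prog_ends _ _ _ l kn cb rb nW (init B l).
- by rewrite /= sizel.
- by split=> v vn; rewrite /= (nth_map d) ?sizel.
- by [].
pose order := by_row #|G| (ncols B) l.
have orderP : perm_eq order (iota 0 #|G|) := perm_by_row kn rb.
(* The listing numbers the vertices of the structure; [g], the inverse of the isomorphism, carries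
   them back to [G]. *)
pose es := [seq nth x0 (map g e) v | v <- order].
have esE : map (w \o f) es = map (nth d l) order.
  rewrite -map_comp; apply/eq_in_map => v.
  rewrite (perm_mem orderP) mem_iota /= => vn.
  by rewrite plE // (nth_map x0) ?size_e // gK.
have [|||||||t [tE kt dt]] := @build_k_expression (ncols B) (model_col (ncols B)) G
    (w \o f) es.
- move=> x y; apply/idP/idP.
    by move=> /fE/(bubble_adjP wP)[ne ->]; rewrite andbT; apply/eqP => xy; apply: ne; rewrite xy.
  move=> /andP[/eqP ne adj]; apply/fE/(bubble_adjP wP); split=> // /(can_inj fK).
  exact: ne.
- by move=> x; have /andP[] := place_index wP (f x).
- by move=> x; have /andP[] := place_index wP (f x).
- by move=> j /cols[x <-]; exists (g x); rewrite /= gK.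
- by rewrite size_map (perm_size orderP) size_iota.
- apply: (@perm_trans _ (map g e)).
    have -> : map g e = [seq nth x0 (map g e) v | v <- iota 0 #|G|].
      by rewrite -{1}(mkseq_nth x0 (map g e)) /mkseq size_map size_e.
    rewrite /es; exact: perm_map.
  apply: uniq_perm; rewrite ?enum_uniq // ?(map_inj_uniq (can_inj gK)).
    by rewrite (perm_uniq eG) enum_uniq.
  move=> x; rewrite mem_enum; apply/mapP; exists (f x); rewrite ?fK //.
  by rewrite (perm_mem eG) mem_enum.
- have : pairwise (fun p q => ~~ key_lt (key q) (key p)) (map (w \o f) es).
    rewrite esE pairwise_map; exact: pairwise_by_row kn cb.
  by rewrite pairwise_map.
exists t, T, s; split=> //; first by lia.
by rewrite oE -/order -esE tE.
Qed.

(** * Unit intervals *)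

Import Order.TTheory GRing.Theory Num.Theory.

(** If [b < a + 1], the midpoint of the overlap is interior to both intervals; if [b = a + 1], only
    the common end point is left. [BSide true] is closed on the left but open on the right, hence
    [~~ ar]. *)
Lemma unit_intervals_meet (R : realType) (a b : R) (al ar bl br : bool) :
  (a <= b)%R ->
  (exists z, (z \in Interval (BSide al a) (BSide ar (a + 1)%R)) &&
             (z \in Interval (BSide bl b) (BSide br (b + 1)%R))) <->
  (b < a + 1)%R \/ b = (a + 1)%R /\ ~~ ar /\ bl.
Proof.
move=> ab; split.
- move=> [z]; rewrite !in_itv /=.
  by move=> /andP[/andP[_ h1] /andP[h2 _]]; case: ar bl h1 h2 => [] [] /= h1 h2; lra.
- case=> [lt|[-> [/negbTE -> ->]]].
    exists ((b + a + 1) / 2)%R; rewrite !in_itv /=.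
    by case: al ar bl br => [] [] [] [] /=; lra.
  exists (a + 1)%R; rewrite !in_itv /= lexx.
  by case: al br => [] [] /=; lra.
Qed.

Section Intervals.
Variables (R : realType) (G : sgraph) (a : G -> R) (cl cr : G -> bool).
Hypothesis edgeE : forall x y : G, sedge x y <-> x <> y /\ exists z : R,
  (z \in Interval (BSide (cl x) (a x)) (BSide (cr x) (a x + 1)%R)) &&
  (z \in Interval (BSide (cl y) (a y)) (BSide (cr y) (a y + 1)%R)).

Let frac (x : G) : R := (a x - (Num.floor (a x))%:~R)%R.
(** A shift that makes all integral parts nonnegative. *)
Let base : nat := \sum_x `|Num.floor (a x)|%N.
Let col (x : G) : nat := `|(Num.floor (a x) + base%:Z)%R|%N.+1.
Let row (x : G) : nat := #|[set y | (frac y < frac x)%R]|.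

(** The sign + stands for a closed end, the first for the left and the second for the right end.
    Rows start at [0], as only their order matters. *)
Definition interval_place (x : G) : place := Place (row x) (col x) (cl x) (~~ cr x).

Lemma frac_itv x : (0 <= frac x < 1)%R.
Proof. by have := floor_itv (a x); rewrite /frac intrD; lra. Qed.

Lemma colE x : ((col x)%:Z)%R = (Num.floor (a x) + base%:Z + 1)%R.
Proof.
have : `|Num.floor (a x)|%N <= base by rewrite /base (bigD1 x) //= leq_addr.
rewrite /col; lia.
Qed.

Lemma lt_row x y : (row x < row y) = (frac x < frac y)%R.
Proof.
have mono u v : (frac u <= frac v)%R -> row u <= row v.
  move=> uv; apply: subset_leq_card; apply/fintype.subsetP => z; rewrite !inE => zu.
  exact: lt_le_trans zu uv.
have [xy|/mono] := ltP (frac x) (frac y); last by rewrite ltnNge => ->.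
apply: proper_card; apply/properP; split; last first.
  by exists x; rewrite !inE ?ltxx.
by apply/fintype.subsetP => z; rewrite !inE => zu; exact: lt_trans zu xy.
Qed.

Lemma eq_row x y : (row x == row y) = (frac x == frac y)%R.
Proof. by rewrite eqn_leq eq_le (leqNgt (row x)) (leqNgt (row y)) !lt_row -!leNgt. Qed.

Lemma aE x : a x = (frac x + (col x)%:R - base%:R - 1)%R.
Proof.
have := colE x; rewrite /frac => e.
have -> : ((col x)%:R = (col x)%:Z%:~R :> R)%R by [].
by rewrite e !intrD /=; lra.
Qed.

(** Let [a x <= a y]. Within a column the left ends differ by less than 1, and at column distance
    two or more by more than 1. For consecutive columns the difference is [1 + frac y - frac x], so
    the rows decide, and equal rows mean intervals that can only touch. *)
Lemma interval_place_edge x y :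
  sedge x y = (x != y) && place_adj (interval_place x) (interval_place y).
Proof.
wlog ab : x y / (a x <= a y)%R.
  move=> H; case/orP: (le_total (a x) (a y)) => /H // e.
  rewrite sedge_sym e eq_sym; congr (_ && _).
  by rewrite /place_adj eq_sym; congr (_ || _); rewrite orbC.
have [ax ay] := (aE x, aE y).
have natD (m n : nat) : m < n -> ((m%:R : R) + 1 <= n%:R)%R.
  by move=> mn; rewrite natr1 ler_nat.
have [fx fy] := (frac_itv x, frac_itv y).
have cyx : ~~ (col y < col x) by apply/negP => /natD; lra.
have adjE : place_adj (interval_place x) (interval_place y) =
    (col x == col y) || ((col x).+1 == col y) &&
      ((frac y < frac x)%R || [&& frac x == frac y, ~~ cr x & cl y]).
  rewrite /place_adj /place_next /= lt_row eq_row; congr (_ || _).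
  by rewrite orb_idr // => /andP[/eqP e _]; move: cyx; lia.
suff H : ((a y < a x + 1)%R \/ a y = (a x + 1)%R /\ ~~ cr x /\ cl y) <->
    place_adj (interval_place x) (interval_place y).
  apply/idP/idP => [/edgeE[/eqP -> /= /(unit_intervals_meet _ _ _ _ ab)/H //]|].
  by move=> /andP[/eqP ne /H/(unit_intervals_meet _ _ _ _ ab) m]; apply/edgeE.
rewrite adjE ax ay.
have [->|ne] := eqVneq (col x) (col y); first by split=> // _; left; lra.
have [cxy|ne'] := eqVneq (col x).+1 (col y) => /=; last first.
  have /natD : (col x).+1 < col y by lia.
  by rewrite -natr1 => h; split=> // -[|[]]; lra.
have [lt|gt|->] := ltgtP (frac x) (frac y); rewrite -cxy -natr1 /=.
- by split=> // -[|[]]; lra.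
- by split=> // _; left; lra.
- split=> [[|[_ [-> ->]]]|/andP[-> ->]] //; first by lra.
  by right; split=> //; lra.
Qed.

Lemma intervals_cwd : cwd_le G (2 * alpha G + 3).
Proof.
apply/asboolP; have [|G0] := posnP #|G|; [by left | right].
pose le x y := ~~ key_lt (key (interval_place y)) (key (interval_place x)).
have tot : total le by move=> x y; rewrite /le /key_lt; lia.
have tr : transitive le by move=> x y z; rewrite /le /key_lt; lia.
pose k := \max_x col x.
(* Unlike in a bubble model, columns up to [k] may be empty here. *)
pose hc j := [exists x, col x == j].
have [||||||t [_ kt dt]] :=
    @build_k_expression k hc G interval_place (sort le (enum G)) interval_place_edge.
- by move=> x; rewrite /= leq_bigmax.
- by move=> x; apply/existsP; exists x.
- by move=> j /existsP[x /eqP]; exists x.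
- by rewrite size_sort -cardE.
- by rewrite perm_sort.
- by rewrite -(sorted_pairwise tr) sort_sorted.
by exists t.
Qed.
End Intervals.

Lemma cwd_mixed_unit_interval (R : realType) (G : sgraph) :
  mixed_unit_interval_graph R G -> cwd G <= 2 * alpha G + 3.
Proof.
move=> [I [Iu IE]].
have /choice[a /choice[bl /choice[br abE]]] : forall x, exists a bl br,
  I x = Interval (BSide bl a) (BSide br (a + 1)%R) by [].
rewrite /cwd; case: ex_minnP => m _; apply.
apply: (@intervals_cwd R G a bl br) => x y.
by rewrite -!abE.
Qed.

Theorem theorem26 (R : realType) :
  (forall G : sgraph, mixed_unit_interval_graph R G ->
     cwd G <= 2 * alpha G + 3) /\
  (exists (p : prog) (c : nat),
     forall (G : sgraph) (B : bubble_structure G) (l : seq place),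
       mixed_unit_interval_graph R G -> bubble_model B -> listing B l ->
       exists (t : cwterm) (T : nat) (s : state),
         [/\ run (c * #|G|) p (init B l) T s,
             T <= c * #|G|,
             out s = code t,
             k_expression (2 * alpha G + 3) t
           & defines t G]).
Proof.
split; first exact: cwd_mixed_unit_interval.
by exists expression_prog, 300 => G B l _; exact: expression_prog_correct.
Qed.
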